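(* Let $a\in\mathbb{R}$. If $a\leq 2$, then every graph $H$ is $a$-easy. If $a\leq 2.5$, then every graph $H$ with no vertex of degree $2$ is $a$-easy. If $a\leq 3$, then every graph $H$ with no vertex of degree $2$ or $3$ is $a$-easy.
   Context: Graphs are finite and simple. A subgraph $G\subseteq H$ of $H=(V,F)$ always means a graph $G=(V,E)$ with the same vertex set $V$ and $E\subseteq F$; $\emptyset$ denotes the empty subgraph $(V,\emptyset)$; $d_v(G)$ is the degree of $v$ in $G$. QDSO over $H$ and $a\in\mathbb{R}$ is the problem $$\max\Big\{f(G)=\sum_{v\in V}d_v(G)\big(d_v(G)-a\big)\ :\ G\subseteq H\Big\}.$$ A subgraph attaining the maximum is called optimal. A connected graph $H$ is $a$-easy if either $G=H$ or $G=\emptyset$ is optimal for QDSO over $H$ and $a$. An arbitrary graph $H$ is $a$-easy if each of its connected components is $a$-easy. *)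

(* Defs.v *)
From HB Require Import structures.
From mathcomp Require Import all_boot all_order all_algebra.
From mathcomp Require Import reals.

Set Implicit Arguments.
Unset Strict Implicit.
Unset Printing Implicit Defensive.

Import Order.TTheory GRing.Theory Num.Theory.
Local Open Scope ring_scope.

Record sgraph (V : finType) := SGraph {
  adj :> rel V;
  adj_sym : symmetric adj;
  adj_irr : irreflexive adj
}.

Section Graphs.
Variable V : finType.
Implicit Types G H : sgraph V.

Definition subgraph G H := forall x y, G x y -> H x y.

Definition edgeless : sgraph V :=
  @SGraph V (fun _ _ => false) (fun _ _ => erefl) (fun _ => erefl).

Definition degree G (v : V) : nat := #|[set u | G v u]|.

Definition connected H := (0 < #|V|)%N /\ forall x y : V, connect H x y.

(* Components are given by their vertex sets. *)
Definition components H : {set {set V}} :=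
  equivalence_partition (connect H) [set: V].

Definition induced H (A : {set V}) : sgraph {x : V | x \in A} :=
  @SGraph {x : V | x \in A} (fun x y => H (val x) (val y))
    (fun _ _ => adj_sym H _ _) (fun _ => adj_irr H _).

Section Qdso.
Variables (R : realType) (a : R).

Definition qdso_value G : R :=
  \sum_(v : V) (degree G v)%:R * ((degree G v)%:R - a).

Definition optimal H G :=
  subgraph G H /\
  forall G', subgraph G' H -> qdso_value G' <= qdso_value G.

(* a-easiness, for connected H only *)
Definition trivially_optimal H := optimal H H \/ optimal H edgeless.

End Qdso.
End Graphs.

(* On connected graphs this agrees with trivially_optimal, see
   easy_connected. *)
Definition easy (R : realType) (a : R) (V : finType) (H : sgraph V) :=
  forall C : {set V}, C \in components H ->
    trivially_optimal a (induced H C).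

Lemma connect_sym_adj (V : finType) (H : sgraph V) : connect_sym H.
Proof. by apply: sym_connect_sym => x y; rewrite adj_sym. Qed.

Lemma connect_equivalence (V : finType) (H : sgraph V) :
  {in [set: V] & &, equivalence_rel (connect H)}.
Proof.
move=> x y z _ _ _; split; first exact: connect0.
by move=> xy; apply: (same_connect (connect_sym_adj H)).
Qed.

Lemma components_connected (V : finType) (H : sgraph V) (C : {set V}) :
  C \in components H -> connected (induced H C).
Proof.
move=> /imsetP[x0 _ defC].
have CE x : (x \in C) = connect H x0 x by rewrite defC !inE.
have walk (u : {x : V | x \in C}) p : path H (val u) p ->
    forall v, val v = last (val u) p -> connect (induced H C) u v.
  elim: p u => [|y p IHp] u /= => [_ v /val_inj-> //|/andP[uy yp] v vE].
  have Cy : y \in C.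
    rewrite CE; apply: (connect_trans (y := val u)); last exact: connect1.
    by rewrite -CE (valP u).
  apply: (connect_trans (y := Sub y Cy)); first exact: connect1.
  exact: IHp.
split=> [|x y].
  by apply/card_gt0P; exists (Sub x0 (etrans (CE x0) (connect0 _ _))).
have /connectP[p xp yE] : connect H (val x) (val y).
  apply: (connect_trans (y := x0)); last by rewrite -CE (valP y).
  by rewrite connect_sym_adj -CE (valP x).
exact: walk xp _ yE.
Qed.

Lemma qdso_value_bij (R : realType) (a : R) (V W : finType) (h : W -> V)
    (G : sgraph V) (K : sgraph W) :
  bijective h -> (forall x y, K x y = G (h x) (h y)) ->
  qdso_value a K = qdso_value a G.
Proof.
move=> hbij KG; rewrite /qdso_value (reindex h) /=; last exact: onW_bij.
apply: eq_bigr => v _; suff -> : degree K v = degree G (h v) by [].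
rewrite /degree -(card_imset _ (bij_inj hbij)); apply: eq_card => u.
have [g hK gK] := hbij; rewrite -[u]gK mem_imset ?inE ?KG //.
exact: bij_inj.
Qed.

Lemma optimal_bij (R : realType) (a : R) (V W : finType) (h : W -> V)
    (H G : sgraph V) (H' G' : sgraph W) :
  bijective h -> (forall x y, H' x y = H (h x) (h y)) ->
  (forall x y, G' x y = G (h x) (h y)) ->
  optimal a H G -> optimal a H' G'.
Proof.
move=> hbij HE GE [GH Gopt]; split=> [x y|K' K'H].
  by rewrite GE HE; apply: GH.
have [g hK gK] := hbij.
pose K := @SGraph V (fun x y => K' (g x) (g y))
  (fun _ _ => adj_sym K' _ _) (fun _ => adj_irr K' _).
have K'E x y : K' x y = K (h x) (h y) by rewrite /= !hK.
rewrite (qdso_value_bij a hbij K'E) (qdso_value_bij a hbij GE).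
by apply: Gopt => x y /= /K'H; rewrite HE !gK.
Qed.

Lemma easy_connected (R : realType) (a : R) (V : finType) (H : sgraph V) :
  connected H -> easy a H <-> trivially_optimal a H.
Proof.
move=> [/card_gt0P[x0 _] Hconn].
have compE C : (C \in components H) = (C == [set: V]).
  have cls x : [set y in [set: V] | connect H x y] = [set: V].
    by apply/setP => y; rewrite !inE Hconn.
  apply/imsetP/eqP => [[x _ ->]|->]; first exact: cls.
  by exists x0; rewrite ?cls.
have valbij : bijective (val : {x : V | x \in [set: V]} -> V).
  by exists (fun x => Sub x (in_setT x)) => x; first exact: val_inj.
have [g vK gK] := valbij.
have gbij : bijective g by exists val.
split=> [easyH|triv C].
  have := easyH [set: V]; rewrite compE eqxx => /(_ isT).
  by case=> opt; [left|right]; apply: (optimal_bij gbij _ _ opt) => x y //=;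
    rewrite !gK.
rewrite compE => /eqP->.
by case: triv => opt; [left|right]; apply: (optimal_bij valbij _ _ opt).
Qed.

(* Main.v *)
Require Import Defs.
From mathcomp Require Import all_boot all_order all_algebra.
From mathcomp Require Import reals.
From mathcomp Require Import lra zify.

(** For a connected graph [H] it is enough that every nonempty subgraph [G]
    satisfies [f G <= f H]: if [f H >= 0] then [H] is optimal, and if [f H < 0]
    then no nonempty subgraph beats the empty one.

    Fix a threshold [t >= a] such that every degree of [H] is at most 1 or at
    least [2 t - 2]; the three claims are [t = 2], [5/2] and [3].  Write [d] for
    the degree of a vertex in [G], [e] for the number of its edges in [H] that
    are missing from [G], and call the vertex uncovered if [d = 0].  The vertex
    contributes [e (e + 2 d - a)] to [f H - f G], and the degree hypothesis
    bounds this below by [(t - 1) e], or by [(t - 1) (e - 2)] if the vertex is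
    uncovered ([vertex_gain]): a missing edge is worth [t - 1] at each end, and
    an uncovered vertex costs two such units.

    So [f H - f G >= 0] once there are at least as many missing edges as
    uncovered vertices.  Growing the nonempty set of covered vertices one vertex
    at a time along edges of the connected graph [H] meets a new edge at each
    step, and none of these edges is in [G] because it touches an uncovered
    vertex ([attaching_darts], [missing_degree_sum]). *)

Set Implicit Arguments.
Unset Strict Implicit.
Unset Printing Implicit Defensive.

Import Order.TTheory GRing.Theory Num.Theory.
Local Open Scope ring_scope.

Lemma crossing_edge (V : finType) (H : sgraph V) (W : {set V}) (x0 y0 : V) :
  connected H -> x0 \in W -> y0 \notin W ->
  exists x y, [/\ x \in W, y \notin W & H x y].
Proof.
move=> [_ connH] Wx0 Wy0.
case: (boolP [exists x, exists y, [&& x \in W, y \notin W & H x y]]).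
  by case/existsP=> x /existsP[y /and3P[Wx Wy Hxy]]; exists x, y.
move=> nocross; suff closedW : closed H (mem W).
  by have := closed_connect closedW (connH x0 y0); rewrite Wx0 (negPf Wy0).
apply: intro_closed => [|x y Hxy Wx]; first exact: connect_sym_adj.
apply: contraNT nocross => Wy; apply/existsP; exists x; apply/existsP; exists y.
exact/and3P.
Qed.

(** Edges are counted as ordered pairs of adjacent vertices, hence twice.
    A vertex joined to [W] by an edge can be moved into [W] at the price of
    that edge, whose two orientations stop being counted. *)
Lemma attaching_darts (V : finType) (H : sgraph V) (W : {set V}) (x0 : V) :
  connected H -> x0 \in W ->
  (2 * #|~: W| <=
     #|[set p : V * V | H p.1 p.2 && ~~ ((p.1 \in W) && (p.2 \in W))]|)%N.
Proof.
move=> connH; move: {2}#|~: W| (leqnn #|~: W|) => n.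
elim: n W => [|n IHn] W leWn Wx0; first by lia.
have [->|] := eqVneq (~: W) set0; first by rewrite cards0 muln0.
case/set0Pn=> y0; rewrite inE => Wy0.
have [x [y [Wx Wy Hxy]]] := crossing_edge connH Wx0 Wy0.
have neq_xy : x != y by apply: contraNneq Wy => <-.
have cardW : #|~: W| = #|~: (y |: W)|.+1.
  by rewrite (cardsD1 y (~: W)) inE Wy setCU setIC -setDE.
have W'x0 : x0 \in y |: W by rewrite !inE Wx0 orbT.
have leW'n : (#|~: (y |: W)| <= n)%N by lia.
rewrite cardW mulnS addnC.
apply: leq_trans (leq_add (IHn _ leW'n W'x0) (leqnn 2)) _.
have card2 : #|[set (x, y); (y, x)]| = 2%N.
  by rewrite cards2 xpair_eqE negb_and neq_xy.
rewrite -{1}card2 -cardsUI [X in (_ + X)%N](_ : _ = 0%N) ?addn0; last first.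
  apply: eq_card0 => -[u v]; rewrite !inE /= !xpair_eqE.
  apply/negbTE/negP=> /andP[/andP[_ /negP nin] /orP[]/andP[/eqP uE /eqP vE]];
    by apply: nin; rewrite uE vE eqxx Wx orbT.
apply/subset_leq_card/subsetP => -[u v]; rewrite !inE /= !xpair_eqE.
case/orP=> [/andP[-> /=]|/orP[]/andP[/eqP-> /eqP->]].
- by apply: contra => /andP[-> ->]; rewrite !orbT.
- by rewrite Hxy (negPf Wy) andbF.
- by rewrite adj_sym Hxy (negPf Wy).
Qed.

Lemma card_darts (V : finType) (r : rel V) :
  #|[set p : V * V | r p.1 p.2]| = (\sum_v #|[set u | r v u]|)%N.
Proof.
rewrite -sum1_card (eq_bigl (fun p : V * V => true && r p.1 p.2)); last first.
  by move=> p; rewrite inE.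
rewrite -(pair_big_dep xpredT r (fun _ _ => 1%N)) /=; apply: eq_bigr => v _.
by rewrite sum1_card; apply: eq_card => u; rewrite inE.
Qed.

Lemma degree_subgraph (V : finType) (G H : sgraph V) (v : V) :
  subgraph G H -> (degree G v <= degree H v)%N.
Proof.
by move=> GH; apply/subset_leq_card/subsetP => u; rewrite !inE; apply: GH.
Qed.

Lemma degree_missing (V : finType) (G H : sgraph V) (v : V) :
  subgraph G H ->
  (degree H v - degree G v = #|[set u | H v u && ~~ G v u]|)%N.
Proof.
move=> GH; rewrite -cardsDS; last by apply/subsetP => u; rewrite !inE; apply: GH.
by apply: eq_card => u; rewrite !inE andbC.
Qed.

Lemma missing_degree_sum (V : finType) (G H : sgraph V) (x0 : V) :
  connected H -> subgraph G H -> (0 < degree G x0)%N ->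
  (2 * #|[set v | degree G v == 0]| <=
     \sum_v (degree H v - degree G v))%N.
Proof.
move=> connH GH Gx0.
rewrite (eq_bigr _ (fun v _ => degree_missing v GH)).
rewrite -(card_darts (fun x y => H x y && ~~ G x y)).
have covered x y : G x y -> (degree G x != 0)%N.
  by move=> Gxy; rewrite -lt0n; apply/card_gt0P; exists y; rewrite inE.
have := @attaching_darts V H [set v | degree G v != 0]%N x0 connH.
rewrite inE -lt0n => /(_ Gx0); rewrite (_ : ~: _ = [set v | degree G v == 0]%N).
  move=> /leq_trans; apply; apply/subset_leq_card/subsetP => -[x y].
  rewrite !inE /= => /andP[-> /=]; apply: contra => Gxy.
  by rewrite (covered _ _ Gxy) (covered y x) // adj_sym.
by apply/setP => v; rewrite !inE negbK.
Qed.

(** For an uncovered vertex of degree [D] and [a = t], the difference of the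
    two sides is [(D - 1) (D - (2 t - 2))], so the hypothesis is exactly that
    the degree avoids the interval where this product is negative.  A covered
    vertex that misses an edge has degree at least 2, hence at least [2 t - 2]. *)
Lemma vertex_gain (R : realType) (a t : R) (d D : nat) :
  a <= t -> 1 <= t -> (d <= D)%N -> (D <= 1)%N \/ 2 * t - 2 <= D%:R ->
  (t - 1) * ((D - d)%:R - 2 * (d == 0)%:R) <=
    D%:R * (D%:R - a) - d%:R * (d%:R - a).
Proof.
move=> leat le1t ledD degD; rewrite natrB //.
have [->|d_neq0] := eqVneq d 0%N.
  rewrite mulr1n.
  case: degD => [|leD]; first by case: (D) => [|[|//]] _; nra.
  have [->|D_neq0] := eqVneq D 0%N; first by nra.
  have le1D : 1 <= D%:R :> R by rewrite ler1n lt0n.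
  by nra.
rewrite mulr0n mulr0 subr0.
have le1d : 1 <= d%:R :> R by rewrite ler1n lt0n.
have [->|neq_dD] := eqVneq d D; first by lra.
have le1e : 1 <= D%:R - d%:R :> R by rewrite -natrB // ler1n; lia.
case: degD => [|leD]; first by lia.
by nra.
Qed.

Lemma qdso_value_nonempty (R : realType) (a t : R) (V : finType)
    (G H : sgraph V) (x0 : V) :
  a <= t -> 1 <= t ->
  (forall v, (degree H v <= 1)%N \/ 2 * t - 2 <= (degree H v)%:R) ->
  connected H -> subgraph G H -> (0 < degree G x0)%N ->
  qdso_value a G <= qdso_value a H.
Proof.
move=> leat le1t degH connH GH Gx0; rewrite -subr_ge0 /qdso_value -sumrB.
have gain v := vertex_gain leat le1t (degree_subgraph v GH) (degH v).
apply: le_trans (ler_sum _ (fun v _ => gain v)).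
rewrite -mulr_sumr mulr_ge0 ?subr_ge0 // sumrB subr_ge0 -mulr_sumr -!natr_sum.
have -> : (\sum_v (degree G v == 0))%N = #|[set v | degree G v == 0]%N|.
  by rewrite -sum1dep_card [RHS]big_mkcond; apply: eq_bigr => v _; case: eqP.
by rewrite -natrM ler_nat; apply: missing_degree_sum Gx0.
Qed.

Lemma qdso_value_degree0 (R : realType) (a : R) (V : finType) (G : sgraph V) :
  (forall v, degree G v = 0%N) -> qdso_value a G = 0.
Proof. by move=> G0; apply: big1 => v _; rewrite G0 mul0r. Qed.

Lemma connected_trivially_optimal (R : realType) (a t : R) (V : finType)
    (H : sgraph V) :
  a <= t -> 1 <= t ->
  (forall v, (degree H v <= 1)%N \/ 2 * t - 2 <= (degree H v)%:R) ->
  connected H -> trivially_optimal a H.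
Proof.
move=> leat le1t degH connH.
have edgeless0 : qdso_value a (edgeless V) = 0.
  by apply: qdso_value_degree0 => v; apply: eq_card0 => u; rewrite inE.
have dichotomy G : subgraph G H ->
    qdso_value a G = 0 \/ qdso_value a G <= qdso_value a H.
  move=> GH; case: (pickP (fun v => 0 < degree G v)%N) => [x0 Gx0|G0].
    by right; exact: (qdso_value_nonempty leat le1t degH connH GH Gx0).
  by left; apply: qdso_value_degree0 => v; apply/eqP; rewrite -leqn0 leqNgt G0.
have [H_ge0|H_lt0] := leP 0 (qdso_value a H); [left | right].
  by split=> // G /dichotomy[->|].
split=> // G /dichotomy[->|leGH]; rewrite edgeless0 //.
exact: le_trans leGH (ltW H_lt0).
Qed.

Lemma degree_component (V : finType) (H : sgraph V) (C : {set V})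
    (x : {x : V | x \in C}) :
  C \in components H -> degree (induced H C) x = degree H (val x).
Proof.
case/imsetP=> x0 _ defC; rewrite /degree -(card_imset _ val_inj).
apply: eq_card => u; rewrite inE; apply/imsetP/idP => [[y + ->]|Hxu].
  by rewrite inE.
have Cu : u \in C.
  have memC y : (y \in C) = connect H x0 y by rewrite defC !inE.
  have := valP x; rewrite !memC => x0x.
  exact: connect_trans x0x (connect1 Hxu).
by exists (Sub u Cu); rewrite ?inE.
Qed.

Lemma easy_of_degrees (R : realType) (a t : R) (V : finType) (H : sgraph V) :
  a <= t -> 1 <= t ->
  (forall v, (degree H v <= 1)%N \/ 2 * t - 2 <= (degree H v)%:R) ->
  easy a H.
Proof.
move=> leat le1t degH C compC.
apply: connected_trivially_optimal leat le1t _ (components_connected compC) => x.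
by rewrite degree_component.
Qed.

Theorem corollary3p6 (R : realType) (a : R) :
  [/\ (a <= 2 ->
        forall (V : finType) (H : sgraph V), easy a H),
      (a <= 5 / 2 ->
        forall (V : finType) (H : sgraph V),
          (forall v : V, degree H v <> 2%N) -> easy a H)
    & (a <= 3 ->
        forall (V : finType) (H : sgraph V),
          (forall v : V, degree H v <> 2%N /\ degree H v <> 3%N) ->
          easy a H)].
Proof.
have threshold (m n : nat) (t : R) :
    2 * t - 2 = m%:R -> (n <= 1)%N \/ (m <= n)%N ->
    (n <= 1)%N \/ 2 * t - 2 <= n%:R.
  by move=> ->; rewrite ler_nat.
split=> leat V H => [|degH|degH];
  apply: easy_of_degrees leat _ _ => [|v]; try lra.
- by apply: (threshold 2%N); [lra | lia].
- by apply: (threshold 3%N); [lra | have := degH v; lia].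
- by apply: (threshold 4%N); [lra | have [] := degH v; lia].
Qed.
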